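(* Let $C\subseteq\mathbb{R}^n$ be prox-regular at a point $\bar x\in C$. Then $C$ is smoothly approximately convex at $\bar x$. Moreover, for every $\epsilon>0$ there exists $\delta>0$ such that for all $x,x'\in C\cap B_\delta(\bar x)$, every averaging map $\gamma:[0,1]\to C$ in the metric space $(C,d_C)$ from $x$ to $x'$ is an $\epsilon$-path from $x$ to $x'$.
   Context: For $\bar x\in C$, the regular normal cone $\widehat N_C(\bar x)$ is the set of $v$ with $\langle v,x-\bar x\rangle\le o(\|x-\bar x\|)$ for $x\in C$; the normal cone $N_C(\bar x)$ is the set of limits $v=\lim v_k$ with $v_k\in\widehat N_C(x_k)$, $x_k\in C$, $x_k\to\bar x$. $C$ is locally closed at $\bar x$ if $C\cap\overline B$ is closed for some closed ball $\overline B$ centered at $\bar x$. $C$ is prox-regular at $\bar x$ if it is locally closed there and for every $\bar v\in N_C(\bar x)$ there are $\epsilon,\rho>0$ with $\langle v,x'-x\rangle\le\rho\|x'-x\|^2$ for all $x,x'\in C\cap B_\epsilon(\bar x)$ and $v\in N_C(x)\cap B_\epsilon(\bar v)$. The length of a curve and the intrinsic distance $d_C(x,y)$ (infimum of Euclidean lengths of curves in $C$ from $x$ to $y$) are the usual ones. An averaging map in $(C,d_C)$ from $x$ to $x'$ is a curve $\gamma:[0,1]\to C$ with $\gamma(0)=x,\gamma(1)=x'$ and $d_C(\gamma(t_1),\gamma(t_2))=|t_1-t_2|\,d_C(x,x')$ for all $t_1,t_2\in[0,1]$. A smooth curve segment $\gamma:[0,1]\to C$ is one extending to a $\mathcal{C}^{(1)}$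 map on an open neighborhood of $[0,1]$. An $\epsilon$-path from $x$ to $x'$ is a smooth curve segment $\gamma:[0,1]\to C$ with $\gamma(0)=x,\gamma(1)=x'$ and $\|\gamma'(t)-(x'-x)\|\le\epsilon\|x'-x\|$ for all $t\in[0,1]$. $C$ is smoothly approximately convex at $\bar x$ if for every $\epsilon>0$ there is a neighborhood $W$ of $\bar x$ such that any $x,x'\in C\cap W$ are joined by an $\epsilon$-path. *)

(* Defs.v *)
From HB Require Import structures.
From mathcomp Require Import all_boot all_order all_algebra.
From mathcomp Require Import all_classical all_reals all_analysis.
Set Implicit Arguments. Unset Strict Implicit. Unset Printing Implicit Defensive.
Import Order.TTheory GRing.Theory Num.Theory.
Import numFieldNormedType.Exports.
Local Open Scope classical_set_scope.
Local Open Scope ring_scope.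

Section Defs.
Variables (R : realType) (n : nat).
Notation vec := 'rV[R]_n.

Definition dotp (u v : vec) : R := \sum_(i < n) u ord0 i * v ord0 i.
Definition enorm (u : vec) : R := Num.sqrt (dotp u u).

Definition eball (c : vec) (r : R) : set vec := [set y | enorm (y - c) < r].
Definition ecball (c : vec) (r : R) : set vec := [set y | enorm (y - c) <= r].

Definition reg_normal_cone (C : set vec) (xb : vec) : set vec :=
  [set v | forall e : R, 0 < e -> exists2 d : R, 0 < d &
     forall x, C x -> enorm (x - xb) < d -> dotp v (x - xb) <= e * enorm (x - xb)].

Definition normal_cone (C : set vec) (xb : vec) : set vec :=
  [set v | exists (xs vs : nat -> vec),
     [/\ forall k, C (xs k), forall k, reg_normal_cone C (xs k) (vs k),
         xs @ \oo --> xb & vs @ \oo --> v] ].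

Definition locally_closed (C : set vec) (xb : vec) : Prop :=
  exists2 r : R, 0 < r & closed (C `&` ecball xb r).

Definition prox_regular (C : set vec) (xb : vec) : Prop :=
  locally_closed C xb /\
  forall vb, normal_cone C xb vb ->
    exists (e : R) (rho : R), [/\ 0 < e, 0 < rho &
      forall x x' v, (C `&` eball xb e) x -> (C `&` eball xb e) x' ->
        (normal_cone C x `&` eball vb e) v ->
        dotp v (x' - x) <= rho * enorm (x' - x) ^+ 2].

Definition curve_length (g : R -> vec) : \bar R :=
  ereal_sup [set l | exists (k : nat) (t : nat -> R),
     [/\ t 0%N = 0, t k = 1, (forall i, (i < k)%N -> t i <= t i.+1) &
         l = (\sum_(i < k) enorm (g (t i.+1) - g (t i)))%:E] ].

Definition curve_in (C : set vec) (x y : vec) (g : R -> vec) : Prop :=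
  [/\ {within `[0, 1], continuous g}, (forall t, 0 <= t <= 1 -> C (g t)),
      g 0 = x & g 1 = y].

(* intrinsic distance d_C(x,y) (= +oo if no curve joins x and y) *)
Definition intrinsic_dist (C : set vec) (x y : vec) : \bar R :=
  ereal_inf [set curve_length g | g in curve_in C x y].

Definition averaging_map (C : set vec) (x x' : vec) (g : R -> vec) : Prop :=
  [/\ (forall t, 0 <= t <= 1 -> C (g t)), g 0 = x, g 1 = x' &
      forall t1 t2, 0 <= t1 <= 1 -> 0 <= t2 <= 1 ->
        intrinsic_dist C (g t1) (g t2) = (`|t1 - t2|%:E * intrinsic_dist C x x')%E].

(* g is C^1 on an open neighbourhood U of [0,1] (g itself serves as the
   extension; only its values on [0,1] are the curve segment) *)
Definition C1_on (U : set R) (g : R -> vec) : Prop :=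
  (forall t, U t -> derivable g t 1) /\
  {in U, continuous (fun t => 'D_1 g t)}.

Definition eps_path (C : set vec) (x x' : vec) (e : R) (g : R -> vec) : Prop :=
  [/\ (forall t, 0 <= t <= 1 -> C (g t)), g 0 = x, g 1 = x' &
      exists (U : set R) (h : R -> vec),
        [/\ open U, `[0, 1] `<=` U, C1_on U h,
            (forall t, 0 <= t <= 1 -> h t = g t) &
            forall t, 0 <= t <= 1 -> enorm ('D_1 h t - (x' - x)) <= e * enorm (x' - x)] ].

Definition smoothly_approx_convex (C : set vec) (xb : vec) : Prop :=
  forall e : R, 0 < e -> exists2 W : set vec, nbhs xb W &
    forall x x', (C `&` W) x -> (C `&` W) x' -> exists g, eps_path C x x' e g.
End Defs.

(* Main.v *)
Require Import Defs.
From HB Require Import structures.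
From mathcomp Require Import all_boot all_order all_algebra.
From mathcomp Require Import all_classical all_reals all_analysis.
From mathcomp Require Import ring lra zify.
Import Order.TTheory GRing.Theory Num.Theory.
Import numFieldNormedType.Exports.
Local Open Scope classical_set_scope.
Local Open Scope ring_scope.

(* Taking the normal [0] in the definition of prox-regularity and rescaling gives
   [<v, y - x> <= k |v| |y - x|^2] for all regular normals [v] at [x] and all [x, y]
   in [C] near [xb].  Among the chains [x = X 0, ..., X N = y] in [C], one minimising
   [\sum |X (i+1) - X i|^2] has each interior point nearest to the midpoint of its
   neighbours, so the midpoint minus the point is a regular normal, and the second
   differences are at most [k] times the sum of the two adjacent squared steps.
   For [N = 2^j] the energy is controlled by refining the chain of level [j - 1], hence
   the second differences are [O(|y - x|^2 / N^2)] uniformly in [N].  A limit along an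
   ultrafilter of the chains and of their scaled steps is a C^1 path whose velocity is
   within [O(|y - x|^2)] of [y - x].

   That path gives [d_C(x, y)^2 <= |y - x|^2 + O(|y - x|^4)].  For an averaging map,
   the parallelogram identity turns this estimate into the same second difference
   bound on the dyadic grids, and the same limit argument shows that it is C^1. *)

(** * Euclidean norm *)

Section Euclidean.
Context {R : realType} {n : nat}.
Implicit Types u v w x y : 'rV[R]_n.

Lemma dotpC u v : dotp u v = dotp v u.
Proof. by apply: eq_bigr => i _; rewrite mulrC. Qed.

Lemma dotpDl u v w : dotp (u + v) w = dotp u w + dotp v w.
Proof. by rewrite -big_split; apply: eq_bigr => i _; rewrite mxE mulrDl. Qed.

Lemma dotpDr u v w : dotp w (u + v) = dotp w u + dotp w v.
Proof. by rewrite dotpC dotpDl !(dotpC w). Qed.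

Lemma dotpZl a u v : dotp (a *: u) v = a * dotp u v.
Proof. by rewrite mulr_sumr; apply: eq_bigr => i _; rewrite mxE mulrA. Qed.

Lemma dotpZr a u v : dotp u (a *: v) = a * dotp u v.
Proof. by rewrite dotpC dotpZl dotpC. Qed.

Lemma dotpNl u v : dotp (- u) v = - dotp u v.
Proof. by rewrite -scaleN1r dotpZl mulN1r. Qed.

Lemma dotpNr u v : dotp u (- v) = - dotp u v.
Proof. by rewrite dotpC dotpNl dotpC. Qed.

Lemma dotp0r u : dotp u 0 = 0.
Proof. by rewrite -(scale0r u) dotpZr mul0r. Qed.

Definition dotpE := (dotpDl, dotpDr, dotpZl, dotpZr, dotpNl, dotpNr).

Lemma dotp_ge0 u : 0 <= dotp u u.
Proof. by apply: sumr_ge0 => i _; rewrite -expr2 sqr_ge0. Qed.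

Lemma enorm_sqr u : enorm u ^+ 2 = dotp u u.
Proof. by rewrite sqr_sqrtr // dotp_ge0. Qed.

Lemma enorm_ge0 u : 0 <= enorm u.
Proof. exact: sqrtr_ge0. Qed.

Lemma enorm0 : enorm (0 : 'rV[R]_n) = 0.
Proof. by rewrite /enorm dotp0r sqrtr0. Qed.

Lemma enormZ a u : enorm (a *: u) = `|a| * enorm u.
Proof.
by rewrite /enorm dotpZl dotpZr mulrA -expr2 sqrtrM ?sqr_ge0 // sqrtr_sqr.
Qed.

Lemma enormN u : enorm (- u) = enorm u.
Proof. by rewrite -scaleN1r enormZ normrN1 mul1r. Qed.

Lemma enormB u v : enorm (u - v) = enorm (v - u).
Proof. by rewrite -enormN opprB. Qed.

Lemma enorm_eq0 u : enorm u = 0 -> u = 0.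
Proof.
move=> u0; have /eqP : dotp u u = 0 by rewrite -enorm_sqr u0 expr0n.
rewrite psumr_eq0 => [/allP ui0|i _]; last by rewrite -expr2 sqr_ge0.
apply/rowP => i; have := ui0 i (mem_index_enum i).
by rewrite -expr2 sqrf_eq0 => /eqP ->; rewrite mxE.
Qed.

Lemma dotp_le u v : dotp u v <= enorm u * enorm v.
Proof.
have [v0|v0] := eqVneq (enorm v) 0.
  by rewrite v0 mulr0 (enorm_eq0 _ v0) dotp0r.
have vp : 0 < enorm v by rewrite lt_neqAle eq_sym v0 enorm_ge0.
have [uv|/ltW uv] := leP (dotp u v) 0.
  by rewrite (le_trans uv) // mulr_ge0 ?enorm_ge0.
have := dotp_ge0 (enorm v ^+ 2 *: u - dotp u v *: v).
rewrite !dotpE -!enorm_sqr (dotpC v u) => H.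
rewrite -(ler_pXn2r (n := 2)) ?nnegrE ?mulr_ge0 ?enorm_ge0 //.
rewrite exprMn -subr_ge0 -(pmulr_rge0 _ (exprn_gt0 2 vp)).
by apply: le_trans H _; rewrite le_eqVlt; apply/orP; left; apply/eqP; ring.
Qed.

Lemma enormD u v : enorm (u + v) <= enorm u + enorm v.
Proof.
rewrite -(ler_pXn2r (n := 2)) ?nnegrE ?addr_ge0 ?enorm_ge0 //.
rewrite enorm_sqr !dotpE -!enorm_sqr (dotpC v u).
by have := dotp_le u v; lra.
Qed.

Lemma enorm_sub_trans v u w : enorm (u - w) <= enorm (u - v) + enorm (v - w).
Proof. by rewrite (le_trans _ (enormD _ _)) // addrA subrK. Qed.

Lemma enorm_sum (I : Type) (s : seq I) (P : pred I) (f : I -> 'rV[R]_n) :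
  enorm (\sum_(i <- s | P i) f i) <= \sum_(i <- s | P i) enorm (f i).
Proof.
elim/big_rec2: _ => [|i y z _ IH]; first by rewrite enorm0.
by rewrite (le_trans (enormD _ _)) // lerD2l.
Qed.

(** It measures how far [y] is from the midpoint of [a] and [b]; it serves both for the energy of
    refined chains and for averaging maps. *)
Lemma parallelogram a b y : enorm (a + b - 2 *: y) ^+ 2 + enorm (b - a) ^+ 2 =
  2 * (enorm (a - y) ^+ 2 + enorm (b - y) ^+ 2).
Proof.
rewrite !enorm_sqr !dotpE (dotpC b a) (dotpC y a) (dotpC y b); ring.
Qed.

Lemma mx_norm_le_enorm u : `|u| <= enorm u.
Proof.
rewrite [X in X <= _]mx_normrE; apply/bigmax_leP; split=> [|[i j] _ /=]; first exact: enorm_ge0.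
rewrite ord1 -(ler_pXn2r (n := 2)) ?nnegrE ?enorm_ge0 // enorm_sqr real_normK ?num_real //.
rewrite /dotp (bigD1 j) //= -expr2 lerDl.
by apply: sumr_ge0 => k _; rewrite -expr2 sqr_ge0.
Qed.

(** The crude factor [n.+1] stays positive for [n = 0], so it can be divided by. *)
Lemma enorm_le_mx_norm u : enorm u <= n.+1%:R * `|u|.
Proof.
rewrite -(ler_pXn2r (n := 2)) ?nnegrE ?enorm_ge0 ?mulr_ge0 // enorm_sqr.
rewrite exprMn /dotp.
have H i : u ord0 i * u ord0 i <= `|u| ^+ 2.
  rewrite -expr2 -real_normK ?num_real // ler_pXn2r ?nnegrE //.
  rewrite [X in _ <= X]mx_normrE.
  exact: (le_bigmax _ (fun ij => `|u ij.1 ij.2|) (ord0, i)).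
apply: (le_trans (ler_sum _ (fun i _ => H i))).
rewrite sumr_const card_ord -[X in X <= _]mulr_natl ler_wpM2r ?sqr_ge0 //.
by rewrite -natrX ler_nat (leq_trans (leqnSn _)) // leq_pmull.
Qed.

(** Row vectors carry the topology of the sup norm, which the two preceding inequalities show
    equivalent to the Euclidean one. *)
Lemma cvg_enormP (I : Type) (F : set_system I) {FF : Filter F}
    (f : I -> 'rV[R]_n) x :
  f @ F --> x <-> (forall e, 0 < e -> \forall i \near F, enorm (f i - x) < e).
Proof.
split=> [/cvgrPdist_lt fx e e0|fx].
  have := fx (e / n.+1%:R) (divr_gt0 e0 (ltr0Sn _ _)).
  apply: filterS => i; rewrite ltr_pdivlMr // distrC mulrC.
  exact: le_lt_trans (enorm_le_mx_norm _).
apply/cvgrPdist_lt => e /fx; apply: filterS => i; rewrite distrC.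
exact: le_lt_trans (mx_norm_le_enorm _).
Qed.

Lemma nbhs_eball x (r : R) : 0 < r -> nbhs x (eball x r).
Proof. by have [H _] := cvg_enormP _ (nbhs x) id x; move=> /(H cvg_id). Qed.

Lemma cvg_enorm (I : Type) (F : set_system I) {FF : Filter F}
    (f : I -> 'rV[R]_n) x : f @ F --> x -> enorm (f i) @[i --> F] --> enorm x.
Proof.
move=> /cvg_enormP fx; apply/cvgrPdist_lt => e /fx.
apply: filterS => i; apply: le_lt_trans.
rewrite ler_norml; have := enormD (f i - x) x; have := enormD (x - f i) (f i).
by rewrite !subrK (enormB x (f i)); lra.
Qed.

Lemma closed_ecball x (r : R) : closed (ecball x r).
Proof.
move=> y cy; rewrite /ecball /= leNgt; apply/negP => ry.
have [z [zr zy]] := cy _ (nbhs_eball y (enorm (y - x) - r) ltac:(lra)).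
move: zr zy; rewrite /ecball /eball /= => zr zy.
by have := enorm_sub_trans z y x; rewrite (enormB y z); lra.
Qed.

Lemma compact_ecball (A : set 'rV[R]_n) x (r : R) :
  closed A -> A `<=` ecball x r -> compact A.
Proof.
move=> Acl Ab; apply: bounded_closed_compact => //.
exists (r + `|x|); split; first exact: num_real.
move=> M rM y /Ab /(le_trans (mx_norm_le_enorm _)) yr.
apply: (le_trans _ (ltW rM)); rewrite -(subrK x y).
by rewrite (le_trans (ler_normD _ _)) // lerD2r.
Qed.

End Euclidean.

(** * Limits along a free ultrafilter *)

Section UltraLimit.

Lemma free_ultrafilter : exists F : set_system nat, UltraFilter F /\ \oo `<=` F.
Proof. by have [F [FU sub]] := ultraFilterLemma (F := \oo) _; exists F. Qed.

(** For an ultrafilter a cluster point is a limit: [F] contains the preimage of each neighbourhood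
    or of its complement. One [F] gives limits for all parameters at once, without subsequences. *)
Lemma ultra_compact_cvg {T : topologicalType} (F : set_system nat) (A : set T) (f : nat -> T) :
  UltraFilter F -> compact A -> (\forall j \near F, A (f j)) ->
  exists2 l, A l & f @ F --> l.
Proof.
move=> FU Aco Af; have [l [Al cl]] := Aco (f @ F) _ Af.
exists l => // B Bl; have [//|nB] := in_ultra_setVsetC (f @^-1` B) FU.
by have [y []] := cl (~` B) B nB Bl.
Qed.

End UltraLimit.

(** * Chains of minimal energy *)

Section Chains.
Context {R : realType} {n : nat}.
Implicit Types (K : set 'rV[R]_n) (x y z : 'rV[R]_n) (X Y : nat -> 'rV[R]_n).

(** Discrete Dirichlet energy without its factor [N]: for a straight uniform chain,
    [N%:R * energy N X] is the squared distance of the endpoints. *)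
Definition energy (N : nat) X : R := \sum_(i < N) enorm (X i.+1 - X i) ^+ 2.

(** Indices beyond [N] are also kept in [K], so that compactness gives a limit at every index. *)
Definition chain K (N : nat) x y X := [/\ X 0%N = x, X N = y & forall i, K (X i)].

Definition min_chain K N x y X :=
  chain K N x y X /\ forall Y, chain K N x y Y -> energy N X <= energy N Y.

Lemma energy_ge0 N X : 0 <= energy N X.
Proof. by apply: sumr_ge0 => i _; rewrite sqr_ge0. Qed.

Lemma cvg_energy (F : set_system nat) {FF : Filter F} N (Y : nat -> nat -> 'rV[R]_n) X :
  (forall i, Y ^~ i @ F --> X i) -> energy N (Y j) @[j --> F] --> energy N X.
Proof.
move=> YX; apply: cvg_big => [|i _].
  by apply: add_continuous.
rewrite expr2; under eq_fun do rewrite expr2.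
by apply: cvgM; apply: cvg_enorm; apply: cvgB.
Qed.

(** Index by index limits of a minimising sequence form a minimiser, the energy being continuous. *)
Lemma ex_min_chain K N x y : compact K -> K x -> K y -> (0 < N)%N ->
  exists X, min_chain K N x y X.
Proof.
move=> Kco Kx Ky N0.
pose A := [set energy N X | X in chain K N x y].
have A0 : has_inf A.
  split.
    exists (energy N (fun i => if i == 0%N then x else y)).
    exists (fun i => if i == 0%N then x else y) => //; split => //.
      by rewrite gtn_eqF.
    by case.
  by exists 0 => _ [X _ <-]; exact: energy_ge0.
have /choice [Y HY] (j : nat) : exists X, chain K N x y X /\ energy N X < inf A + j.+1%:R^-1.
  have j0 : 0 < j.+1%:R^-1 :> R by rewrite invr_gt0.
  have [_ [X cX <-] eX] := inf_adherent j0 A0.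
  by exists X.
have [F [FU Foo]] := free_ultrafilter.
have /choice [X HX] i : exists l, K l /\ Y ^~ i @ F --> l.
  have [|l Kl cl] := ultra_compact_cvg F K (Y ^~ i) FU Kco; last by exists l.
  by apply: filterE => j; have [[]] := HY j.
have endX i z : (forall j, Y j i = z) -> X i = z.
  move=> Yz; have [_] := HX i; rewrite (_ : Y ^~ i = fun=> z); last exact/funext.
  by move=> /(cvg_unique (@norm_hausdorff _ _)); apply; exact: cvg_cst.
exists X; split.
  split; [apply: endX => j|apply: endX => j|by move=> i; have [] := HX i];
    by have [[]] := HY j.
move=> Z cZ; have {cZ} : inf A <= energy N Z by apply: ge_inf; [case: A0|exists Z].
apply: le_trans.
have cE : energy N (Y j) @[j --> F] --> energy N X.
  by apply: cvg_energy => i; have [] := HX i.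
have cI : inf A + j.+1%:R^-1 @[j --> F] --> inf A + 0.
  apply: cvgD; first exact: cvg_cst.
  by apply: cvg_trans (@cvg_harmonic R); apply: cvg_app.
rewrite -[leRHS]addr0. 
apply: ler_cvg_to cE cI _.
by apply: filterE => j; have [_ /ltW] := HY j.
Qed.

(** Moving one interior point changes only the two adjacent terms of the energy. *)
Lemma min_chain_local K N x y X i z : min_chain K N x y X -> (i.+1 < N)%N -> K z ->
  enorm (X i - X i.+1) ^+ 2 + enorm (X i.+2 - X i.+1) ^+ 2 <=
  enorm (X i - z) ^+ 2 + enorm (X i.+2 - z) ^+ 2.
Proof.
move=> [[X0 XN XK] Xmin] iN Kz.
pose Y k := if k == i.+1 then z else X k.
have /Xmin : chain K N x y Y.
  by split=> [//||k]; rewrite /Y; [rewrite gtn_eqF|case: ifP].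
have iN' := ltnW iN.
have ii : Ordinal iN != Ordinal iN' by rewrite -val_eqE /= gtn_eqF.
have split_energy Z : energy N Z = enorm (Z i.+1 - Z i) ^+ 2 +
    (enorm (Z i.+2 - Z i.+1) ^+ 2 +
     \sum_(k < N | (k != Ordinal iN') && (k != Ordinal iN)) enorm (Z k.+1 - Z k) ^+ 2).
  by rewrite /energy (bigD1 (Ordinal iN')) //= (bigD1 (Ordinal iN)).
rewrite !split_energy.
have -> : Y i.+1 = z by rewrite /Y eqxx.
have -> : Y i = X i by rewrite /Y ltn_eqF.
have -> : Y i.+2 = X i.+2 by rewrite /Y gtn_eqF.
rewrite (enormB (X i)) (enormB (X i) z) !addrA.
rewrite [X in _ <= _ + X](_ : _ = \sum_(k < N | (k != Ordinal iN') && (k != Ordinal iN))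
    enorm (X k.+1 - X k) ^+ 2); first by rewrite lerD2r.
apply: eq_bigr => k; rewrite -!val_eqE /= => /andP[k1 k2].
by rewrite /Y eqSS (negbTE k1) (negbTE k2).
Qed.

Lemma chain_dist (X : nat -> 'rV[R]_n) i k : (i <= k)%N ->
  enorm (X k - X i) <= \sum_(i <= l < k) enorm (X l.+1 - X l).
Proof. by move=> ik; rewrite -telescope_sumr // enorm_sum. Qed.

Lemma sumr_sub_range (f : nat -> R) N i j : (forall l, 0 <= f l) -> (i <= j)%N -> (j <= N)%N ->
  \sum_(i <= l < j) f l <= \sum_(l < N) f l.
Proof.
move=> f0 ij jN; rewrite -(big_mkord xpredT f).
rewrite [leRHS](big_cat_nat (n := j)) //= [X in _ <= X + _](big_cat_nat (n := i)) //=.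
by rewrite -addrA addrCA lerDl addr_ge0 // sumr_ge0.
Qed.

(** The vector inside the norm is the sum over [j < N] of step [i] minus step [j]. *)
Lemma step_mean_dev X N B i : (forall j, (j < N)%N ->
    enorm ((X i.+1 - X i) - (X j.+1 - X j)) <= B) ->
  enorm (N%:R *: (X i.+1 - X i) - (X N - X 0%N)) <= N%:R * B.
Proof.
move=> dev; rewrite -(telescope_sumr X (leq0n N)) big_mkord.
rewrite scaler_nat -[X in _ *+ X]card_ord -sumr_const -sumrB.
apply: (le_trans (enorm_sum _ _ _ _)).
rewrite -[X in _ <= X%:R * _]card_ord mulr_natl -sumr_const.
by apply: ler_sum => j _; exact: dev.
Qed.

Lemma energy_double N X : energy N.*2 X =
  \sum_(i < N) (enorm (X i.*2.+1 - X i.*2) ^+ 2 + enorm (X i.*2.+2 - X i.*2.+1) ^+ 2).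
Proof.
elim: N => [|N IH]; first by rewrite /energy !big_ord0.
by rewrite doubleS /energy !big_ord_recr /= -/(energy N.*2 X) IH addrA.
Qed.

Lemma second_diffE X i :
  (X i.+2 - X i.+1) - (X i.+1 - X i) = X i + X i.+2 - 2 *: X i.+1.
Proof. by apply/rowP => j; rewrite !mxE; ring. Qed.

End Chains.

(** * Dyadic limits of chains *)

Section DyadicLimit.
Context {R : realType} {n : nat}.
Implicit Types (X : nat -> 'rV[R]_n) (g h w : R -> 'rV[R]_n).

Lemma is_derive_quadratic h (t : R) (d : 'rV[R]_n) (M : R) :
  (forall s, enorm (h s - h t - (s - t) *: d) <= M * (s - t) ^+ 2) -> is_derive t 1 h d.
Proof.
move=> hM.
have cv : (fun s : R => s^-1 *: ((h \o shift t) (s *: 1) - h t)) @ 0^' --> d.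
  apply/cvg_enormP => e e0.
  have M0 : 0 < `|M| + 1 by rewrite ltr_wpDl.
  have : \forall s \near (0 : R)^', `|s| < e / (`|M| + 1).
    by apply: dnbhs0_lt; exact: divr_gt0.
  apply: filterS2 (nbhs_dnbhs_neq (0 : R)) => s s0 se.
  have -> : s^-1 *: ((h \o shift t) (s *: 1) - h t) - d =
      s^-1 *: (h (s + t) - h t - (s + t - t) *: d).
    by rewrite addrK [RHS]scalerBr scalerA mulVf // scale1r /= [s *: 1]mulr1.
  rewrite enormZ normfV ltr_pdivrMl ?normr_gt0 //.
  apply: le_lt_trans (hM _) _; rewrite addrK -normr_gt0 in s0 *.
  rewrite -(real_normK (num_real s)) expr2 mulrCA ltr_pM2l //.
  move: se; rewrite ltr_pdivlMr // mulrC => se; apply: le_lt_trans se.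
  by have := ler_norm M; have := normr_ge0 s; nra.
apply: DeriveDef; first by apply/cvg_ex; exists d.
exact: cvg_lim cv.
Qed.

(** * Velocity estimates from a bound on second differences *)

Section Steps.
Variables (X : nat -> 'rV[R]_n) (N : nat) (K : R).
Hypotheses (N_gt0 : (0 < N)%N) (K_ge0 : 0 <= K).
Hypothesis second_diff : forall i, (i.+1 < N)%N ->
  enorm (X i + X i.+2 - 2 *: X i.+1) <= K / N%:R ^+ 2.
Let v i := X i.+1 - X i.
Let u := X N - X 0%N.

Let N0 : 0 < N%:R :> R. Proof. by rewrite ltr0n. Qed.

(** With time step [1 / N], [N%:R *: v i] is a discrete velocity, and the hypothesis bounds its
    difference quotients by [K]. *)
Lemma step_lipschitz a b : (a <= b)%N -> (b < N)%N ->
  N%:R * enorm (v b - v a) <= K * (b%:R / N%:R - a%:R / N%:R).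
Proof.
move=> ab bN; have H : enorm (v b - v a) <= (b - a)%N%:R * (K / N%:R ^+ 2).
  apply: le_trans (chain_dist _ _ _ ab) _.
  rewrite mulr_natl -sumr_const_nat; apply: ler_sum_nat => l /andP[_ lb].
  by rewrite /v second_diffE second_diff // (leq_ltn_trans lb).
apply: le_trans (ler_wpM2l (ltW N0) H) _; rewrite natrB //.
by rewrite le_eqVlt; apply/orP; left; apply/eqP; field; rewrite gt_eqF.
Qed.

(** [u] is the mean of the scaled steps, and any two of these differ by at most [K]. *)
Lemma step_sub_mean i : (i < N)%N -> enorm (N%:R *: v i - u) <= K.
Proof.
move=> iN; rewrite -[leRHS](divfK (lt0r_neq0 N0)) mulrC.
apply: step_mean_dev => j jN; rewrite ler_pdivlMr // mulrC.
wlog ij : i j iN jN / (j <= i)%N.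
  move=> H; have [ij|/ltnW ij] := leqP j i; first exact: H.
  by rewrite enormB; exact: H.
apply: le_trans (step_lipschitz _ _ ij iN) _.
rewrite ler_piMr // -mulrBl ler_pdivrMr // mul1r lerBlDr.
by rewrite (le_trans (_ : _ <= N%:R)) ?lerDl // ler_nat ltnW.
Qed.

Lemma increment_sub_mean a b : (a <= b)%N -> (b <= N)%N ->
  enorm (X b - X a - (b%:R / N%:R - a%:R / N%:R) *: u) <= K * (b%:R / N%:R - a%:R / N%:R).
Proof.
move=> ab bN; rewrite -mulrBl -natrB // -(telescope_sumr X ab) -scalerA scaler_nat.
rewrite -sumr_const_nat -sumrB; apply: (le_trans (enorm_sum _ _ _ _)).
rewrite mulrCA mulr_natl -sumr_const_nat; apply: ler_sum_nat => l /andP[_ lb].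
have := step_sub_mean l (leq_trans lb bN).
have -> : N%:R *: v l - u = N%:R *: (X l.+1 - X l - N%:R^-1 *: u).
  by rewrite [RHS]scalerBr scalerA divff ?gt_eqF // scale1r.
by rewrite enormZ normr_nat ler_pdivlMr // mulrC.
Qed.

(** Each step with index in [[a, b)] differs from step [c] by at most [K (b - a) / N^2]; summing
    [b - a] of them gives a second order remainder. *)
Lemma increment_sub_step a b c : (a <= c)%N -> (c <= b)%N -> (b <= N)%N -> (c < N)%N ->
  enorm (X b - X a - (b%:R / N%:R - a%:R / N%:R) *: (N%:R *: v c)) <=
  K * (b%:R / N%:R - a%:R / N%:R) ^+ 2.
Proof.
move=> ac cb bN cN; have ab := leq_trans ac cb.
have -> : X b - X a - (b%:R / N%:R - a%:R / N%:R) *: (N%:R *: v c) =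
    \sum_(a <= l < b) (v l - v c).
  rewrite sumrB sumr_const_nat telescope_sumr // scalerA -mulrBl divfK ?gt_eqF //.
  by rewrite -natrB // scaler_nat.
apply: (le_trans (enorm_sum _ _ _ _)).
have -> : K * (b%:R / N%:R - a%:R / N%:R) ^+ 2 =
    \sum_(a <= l < b) (N%:R^-1 * (K * (b%:R / N%:R - a%:R / N%:R))).
  rewrite sumr_const_nat -[RHS]mulr_natl natrB //; ring.
apply: ler_sum_nat => l /andP[al lb]; rewrite ler_pdivlMl //.
have mono p q : (a <= p)%N -> (p <= q)%N -> (q <= b)%N ->
    K * (q%:R / N%:R - p%:R / N%:R) <= K * (b%:R / N%:R - a%:R / N%:R).
  move=> ap pq qb; rewrite ler_wpM2l // lerB // ler_pM2r ?invr_gt0 // ler_nat //.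
have [lc|/ltnW lc] := leqP l c.
  by rewrite enormB; apply: le_trans (step_lipschitz _ _ lc cN) _; exact: mono.
apply: le_trans (step_lipschitz _ _ lc (leq_trans lb bN)) _; apply: mono => //.
exact: ltnW.
Qed.

End Steps.
Lemma cvg_enorm_le (F : set_system nat) (FF : ProperFilter F)
    (f : nat -> 'rV[R]_n) l (s : nat -> R) t :
  f @ F --> l -> s @ F --> t -> (forall j, enorm (f j) <= s j) -> enorm l <= t.
Proof.
move=> fl st fs; apply: ler_cvg_to (cvg_enorm _ _ _ _ fl) st _.
exact: filterE.
Qed.

(** * Passage to the limit along finer dyadic chains *)

Section Limit.
Variables (F : set_system nat) (FU : UltraFilter F) (Foo : \oo `<=` F).
Variables (X : nat -> nat -> 'rV[R]_n) (x y : 'rV[R]_n) (K : R).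
Hypotheses (K_ge0 : 0 <= K) (X0 : forall j, X j 0%N = x) (XN : forall j, X j (2 ^ j)%N = y).
Hypothesis second_diff : forall j i, (i.+1 < 2 ^ j)%N ->
  enorm (X j i + X j i.+2 - 2 *: X j i.+1) <= K / (2 ^ j)%:R ^+ 2.
Let u : 'rV[R]_n := y - x.

Let N0n j : (0 < 2 ^ j)%N. Proof. by rewrite expn_gt0. Qed.
Let N0 j : 0 < (2 ^ j)%:R :> R. Proof. by rewrite ltr0n. Qed.

(** The slack of two grid steps covers both roundings used below, [node] and [cell]. *)
Lemma cvg_dyadic (f : nat -> nat) (t : R) :
  (forall j, `|t - (f j)%:R / (2 ^ j)%:R| <= 2 / (2 ^ j)%:R) ->
  (f j)%:R / (2 ^ j)%:R @[j --> F] --> t.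
Proof.
move=> ft; apply/cvgrPdist_le => e e0.
have : 2 / (2 ^ j)%:R @[j --> \oo] --> (2 * 0 : R).
  apply: cvgM; first exact: cvg_cst.
  under eq_fun do rewrite natrX -exprVn.
  by apply: cvg_expr; rewrite ger0_norm ?invr_ge0 // invf_lt1 ?ltr1n.
rewrite mulr0 => /cvgrPdist_le /(_ _ e0) /Foo; apply: filterS => j.
rewrite sub0r normrN ger0_norm; last by rewrite divr_ge0 // ltW.
exact: le_trans.
Qed.

Let node (t : R) j := Num.truncn (t * (2 ^ j)%:R).
(** The cap matters at [t = 1], where [node] is the last point and no step of the chain starts. *)
Let cell (t : R) j := minn (node t j) (2 ^ j).-1.

Let node_itv (t : R) j : 0 <= t -> (node t j)%:R <= t * (2 ^ j)%:R < (node t j)%:R + 1.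
Proof.
by move=> t0; rewrite natr1; apply: truncn_itv; rewrite mulr_ge0 // ltW.
Qed.

Let node_le (t : R) j : 0 <= t <= 1 -> (node t j <= 2 ^ j)%N.
Proof.
move=> /andP[t0 t1]; rewrite -(ler_nat R).
by have /andP[/le_trans -> //] := node_itv t j t0; rewrite ler_piMl // ltW.
Qed.

Let node_lt (t : R) j : 0 <= t < 1 -> (node t j < 2 ^ j)%N.
Proof.
move=> /andP[t0 t1]; rewrite -(ltr_nat R).
by have /andP[/le_lt_trans -> //] := node_itv t j t0; rewrite gtr_pMl.
Qed.

Let node_homo (s t : R) j : s <= t -> (node s j <= node t j)%N.
Proof. by move=> st; apply: le_truncn; rewrite ler_pM2r. Qed.

Let cell_lt t j : (cell t j < 2 ^ j)%N.
Proof. by rewrite gtn_min (prednK (N0n j)) leqnn orbT. Qed.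

Lemma cvg_trunc_dyadic (t : R) : 0 <= t <= 1 ->
  (Num.truncn (t * (2 ^ j)%:R))%:R / (2 ^ j)%:R @[j --> F] --> t.
Proof.
move=> /andP[t0 t1]; apply: cvg_dyadic => j; have := node_itv t j t0.
rewrite -/(node t j) -ler_pdivrMr // -ltr_pdivlMr // mulrDl mul1r => /andP[a b].
rewrite ger0_norm ?subr_ge0 //.
have : 0 <= (2 ^ j)%:R^-1 :> R by rewrite invr_ge0 ltW.
lra.
Qed.

Let cvg_cell (t : R) : 0 <= t <= 1 -> (cell t j)%:R / (2 ^ j)%:R @[j --> F] --> t.
Proof.
move=> t01; have /andP[t0 t1] := t01; apply: cvg_dyadic => j; have := node_itv t j t0.
have : (cell t j)%:R <= ((node t j)%:R : R) <= (cell t j)%:R + 1.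
  rewrite natr1 !ler_nat geq_minl /= /cell.
  move: (node_le t j t01) (N0n j); move: (node t j) (2 ^ j)%N => a N.
  by clear; lia.
move=> /andP[c1 c2] /andP[n1 n2].
rewrite -(ler_pM2r (N0 j)) divfK ?gt_eqF // -{2}(ger0_norm (ltW (N0 j))) -normrM.
rewrite mulrBl divfK ?gt_eqF //; rewrite ger0_norm; lra.
Qed.

(** [g] is the limit of the chains and [w] that of their scaled steps. The last bound makes [w] the
    derivative of [g] without interchanging limits and derivatives. *)
Lemma dyadic_limit_segment : exists g w : R -> 'rV[R]_n, [/\
  forall t, 0 <= t <= 1 -> X j (Num.truncn (t * (2 ^ j)%:R)) @[j --> F] --> g t,
  forall t, 0 <= t <= 1 -> enorm (w t - u) <= K,
  forall a b, 0 <= a -> a <= b -> b <= 1 -> enorm (w b - w a) <= K * (b - a),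
  forall a b, 0 <= a -> a <= b -> b <= 1 -> enorm (g b - g a - (b - a) *: u) <= K * (b - a) &
  forall a b c, 0 <= a -> a <= c -> c <= b -> b <= 1 ->
    enorm (g b - g a - (b - a) *: w c) <= K * (b - a) ^+ 2].
Proof.
pose v j i : 'rV[R]_n := X j i.+1 - X j i.
have incM j a b := increment_sub_mean (X j) (2 ^ j) K (N0n j) K_ge0 (second_diff j) a b.
have incS j a b c := increment_sub_step (X j) (2 ^ j) K (N0n j) K_ge0 (second_diff j) a b c.
have stepM j i := step_sub_mean (X j) (2 ^ j) K (N0n j) K_ge0 (second_diff j) i.
have stepL j a b := step_lipschitz (X j) (2 ^ j) K (N0n j) (second_diff j) a b.
have uE j : X j (2 ^ j)%N - X j 0%N = u by rewrite X0 XN.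
have compB (c : 'rV[R]_n) (r : R) : compact (ecball c r).
  exact: (compact_ecball _ c r (closed_ecball c r)).
have /choice [g gP] (t : R) : exists l : 'rV[R]_n, 0 <= t <= 1 -> X j (node t j) @[j --> F] --> l.
  have [t01|_] := boolP (0 <= t <= 1); last by exists 0.
  have [|l _ cl] := ultra_compact_cvg F (ecball x (enorm u + K)) (fun j => X j (node t j)) FU (compB _ _).
    apply: filterE => j; rewrite /ecball /=.
    have := incM j 0%N (node t j) (leq0n _) (node_le t j t01).
    rewrite uE X0 mul0r subr0; set s := _ / _ => H.
    have s01 : 0 <= s <= 1.
      rewrite /s ler_pdivrMr // mul1r ler_nat node_le // andbT.
      by rewrite divr_ge0 // ltW.
    rewrite -(subrK (s *: u) (_ - x)) (le_trans (enormD _ _)) // enormZ addrC.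
    case/andP: s01 => s0 s1; rewrite ger0_norm //; apply: lerD.
      by rewrite ler_piMl ?enorm_ge0.
    by apply: le_trans H _; rewrite ler_piMr.
  by exists l.
have /choice [w wP] (t : R) : exists l : 'rV[R]_n, 0 <= t <= 1 ->
    enorm (l - u) <= K /\ (2 ^ j)%:R *: v j (cell t j) @[j --> F] --> l.
  have [t01|_] := boolP (0 <= t <= 1); last by exists 0.
  have [|l Bl cl] := ultra_compact_cvg F (ecball u K)
    (fun j => (2 ^ j)%:R *: v j (cell t j)) FU (compB _ _); last by exists l.
  by apply: filterE => j; rewrite /ecball /= -(uE j); exact: stepM.
exists g, w; split.
- exact: gP.
- by move=> t /wP[].
- move=> a b a0 ab b1.
  have [a01 b01] : 0 <= a <= 1 /\ 0 <= b <= 1 by split; apply/andP; split; lra.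
  apply: (cvg_enorm_le F _ _ _ _ _ (cvgB (wP b b01).2 (wP a a01).2)
    (cvgM (cvg_cst K) (cvgB (cvg_cell b b01) (cvg_cell a a01)))) => j /=.
  rewrite !fctE /= -scalerBr enormZ normr_nat; apply: stepL (cell_lt b j).
  by rewrite leq_min geq_minr andbT (leq_trans (geq_minl _ _)) // node_homo.
- move=> a b a0 ab b1.
  have [a01 b01] : 0 <= a <= 1 /\ 0 <= b <= 1 by split; apply/andP; split; lra.
  apply: (cvg_enorm_le F _ _ _ _ _
    (cvgB (cvgB (gP b b01) (gP a a01))
      (cvgZ (cvgB (cvg_trunc_dyadic b b01) (cvg_trunc_dyadic a a01)) (cvg_cst u)))
    (cvgM (cvg_cst K) (cvgB (cvg_trunc_dyadic b b01) (cvg_trunc_dyadic a a01)))) => j /=.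
  by rewrite !fctE /= -(uE j); apply: incM; [exact: node_homo|exact: node_le].
- move=> a b c a0 ac cb b1.
  (* The degenerate case is split off because [node a <= cell c] uses [a < 1], which follows from
     [a < b <= 1]. *)
  have [ab|ab] := eqVneq a b.
    by rewrite ab !subrr scale0r subr0 enorm0 expr0n mulr0.
  have {}ab : a < b by rewrite lt_neqAle ab (le_trans ac).
  have [a01 b01 c01] : [/\ 0 <= a <= 1, 0 <= b <= 1 & 0 <= c <= 1].
    by split; apply/andP; split; lra.
  apply: (cvg_enorm_le F _ _ _ _ _
    (cvgB (cvgB (gP b b01) (gP a a01))
      (cvgZ (cvgB (cvg_trunc_dyadic b b01) (cvg_trunc_dyadic a a01)) (wP c c01).2))
    (cvgM (cvg_cst K) (cvgM (cvgB (cvg_trunc_dyadic b b01) (cvg_trunc_dyadic a a01))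
      (cvgB (cvg_trunc_dyadic b b01) (cvg_trunc_dyadic a a01))))) => j /=.
  rewrite !fctE /=; apply: incS; last exact: cell_lt.
  + rewrite leq_min node_homo //= -ltnS (prednK (N0n j)).
    by apply: node_lt; rewrite a0 /=; lra.
  + by rewrite (leq_trans (geq_minl _ _)) // node_homo.
  + exact: node_le.
Qed.

End Limit.

End DyadicLimit.

(** * Extension of a path to a C^1 map on the line *)

Section C1Extension.
Context {R : realType} {n : nat}.
Implicit Types (g h w : R -> 'rV[R]_n) (C : set 'rV[R]_n) (x y : 'rV[R]_n).

Definition clamp01 (t : R) : R := Num.max 0 (Num.min t 1).

Lemma clamp01P (t : R) : [\/ t < 0 /\ clamp01 t = 0, 0 <= t <= 1 /\ clamp01 t = t |
  1 < t /\ clamp01 t = 1].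
Proof.
rewrite /clamp01; have [t1|t1] := leP t 1; have [t0|t0] := leP 0 t; rewrite /=.
- by constructor 2; split=> //; rewrite t1.
- by constructor 1.
- by constructor 3; split=> //; apply/max_idPr.
- by lra.
Qed.

Lemma clamp01_itv (t : R) : 0 <= clamp01 t <= 1.
Proof. by have [[_ ->]|[t01 ->]|[_ ->]] := clamp01P t; rewrite ?lexx ?ler01. Qed.

Lemma clamp01_id (t : R) : 0 <= t <= 1 -> clamp01 t = t.
Proof. by have [[]|[_ ->]|[]] := clamp01P t => //; lra. Qed.

Lemma clamp01_contract (s t : R) : `|clamp01 s - clamp01 t| <= `|s - t|.
Proof.
have := ler_norm (s - t); have := ler_norm (t - s); rewrite (distrC t s) ler_norml.
by have [[? ->]|[/andP[? ?] ->]|[? ->]] := clamp01P s;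
   have [[? ->]|[/andP[? ?] ->]|[? ->]] := clamp01P t; lra.
Qed.

(** Unless the product vanishes, [s] is outside the unit interval and [clamp01 s] separates it from
    [t], so both factors are at most [|s - t|]. *)
Lemma clamp01_cross (s t : R) : `|s - clamp01 s| * `|clamp01 s - clamp01 t| <= (s - t) ^+ 2.
Proof.
have [->|st] := eqVneq (clamp01 s) (clamp01 t); first by rewrite subrr normr0 mulr0 sqr_ge0.
rewrite -(real_normK (num_real (s - t))) expr2 ler_pM // ?clamp01_contract //.
move: st; have [[? ->]|[/andP[? ?] ->]|[? ->]] := clamp01P s.
- have [[? ->]|[/andP[? ?] ->]|[? ->]] := clamp01P t; rewrite ?eqxx // => _;
    rewrite !ler0_norm; lra.
- by rewrite subrr normr0.
- have [[? ->]|[/andP[? ?] ->]|[? ->]] := clamp01P t; rewrite ?eqxx // => _;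
    rewrite !ger0_norm; lra.
Qed.

Lemma continuous_lipschitz w (K : R) :
  (forall s t, enorm (w s - w t) <= K * `|s - t|) -> continuous w.
Proof.
move=> wK t; apply/cvg_enormP => e e0.
have M0 : 0 < `|K| + 1 by rewrite ltr_wpDl.
have /cvgrPdist_lt /(_ _ (divr_gt0 e0 M0)) : id @ t --> t by exact: cvg_id.
apply: filterS => s; rewrite ltr_pdivlMr // distrC => se.
apply: le_lt_trans (wK s t) _; apply: le_lt_trans se; rewrite mulrC ler_wpM2l //.
by rewrite (le_trans (ler_norm K)) // lerDl.
Qed.

(* [h] continues [g] linearly outside the unit interval. *)
Lemma C1_extension g w (K : R) : 0 <= K ->
  (forall a b, 0 <= a -> a <= b -> b <= 1 -> enorm (w b - w a) <= K * (b - a)) ->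
  (forall a b c, 0 <= a -> a <= c -> c <= b -> b <= 1 ->
    enorm (g b - g a - (b - a) *: w c) <= K * (b - a) ^+ 2) ->
  exists h, [/\ forall t, 0 <= t <= 1 -> h t = g t,
    forall t : R, is_derive t (1 : R) h (w (clamp01 t)) & continuous (w \o clamp01)].
Proof.
move=> K0 wK gK.
have wK' s t : enorm (w (clamp01 s) - w (clamp01 t)) <= K * `|clamp01 s - clamp01 t|.
  have /andP[s0 s1] := clamp01_itv s; have /andP[t0 t1] := clamp01_itv t.
  have [st|/ltW st] := leP (clamp01 s) (clamp01 t).
    by rewrite enormB ler0_norm ?subr_le0 // opprB; exact: wK.
  by rewrite ger0_norm ?subr_ge0 //; exact: wK.
have gK' s t : enorm (g (clamp01 s) - g (clamp01 t) - (clamp01 s - clamp01 t) *: w (clamp01 t)) <=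
    K * (clamp01 s - clamp01 t) ^+ 2.
  have /andP[s0 s1] := clamp01_itv s; have /andP[t0 t1] := clamp01_itv t.
  have [st|/ltW st] := leP (clamp01 s) (clamp01 t); last exact: gK.
  set a := clamp01 s in st s0 s1 *; set b := clamp01 t in st t0 t1 *.
  have -> : g a - g b - (a - b) *: w b = - (g b - g a - (b - a) *: w b).
    by apply/rowP => i; rewrite !mxE; ring.
  by rewrite enormN -sqrrN opprB; exact: gK.
exists (fun t => g (clamp01 t) + (t - clamp01 t) *: w (clamp01 t)); split.
- by move=> t t01; rewrite clamp01_id // subrr scale0r addr0.
(* One [K] pays for the remainder of [g], the other for the change of velocity along the linear
   part, where the cross bound applies. *)
- move=> t; apply: (@is_derive_quadratic _ _ _ _ _ (2 * K)) => s.
  set cs := clamp01 s; set ct := clamp01 t.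
  have -> : g cs + (s - cs) *: w cs - (g ct + (t - ct) *: w ct) - (s - t) *: w ct =
      (g cs - g ct - (cs - ct) *: w ct) + (s - cs) *: (w cs - w ct).
    by apply/rowP => i; rewrite !mxE; ring.
  apply: le_trans (enormD _ _) _; rewrite enormZ mulrDl !mul1r [leRHS]mulrDl; apply: lerD.
    apply: le_trans (gK' s t) _; rewrite ler_wpM2l // -(real_normK (num_real (_ - _))).
    by rewrite -[leRHS]real_normK ?num_real // ler_pXn2r ?nnegrE // clamp01_contract.
  apply: le_trans (ler_wpM2l (normr_ge0 _) (wK' s t)) _.
  by rewrite mulrCA ler_wpM2l // clamp01_cross.
- apply: (continuous_lipschitz _ K) => s t; apply: le_trans (wK' s t) _.
  by rewrite ler_wpM2l // clamp01_contract.
Qed.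

Lemma eps_path_C1 C x y (e : R) g h w : (forall t, 0 <= t <= 1 -> C (g t)) ->
  g 0 = x -> g 1 = y -> (forall t, 0 <= t <= 1 -> h t = g t) ->
  (forall t : R, is_derive t (1 : R) h (w t)) -> continuous w ->
  (forall t, enorm (w t - (y - x)) <= e * enorm (y - x)) -> eps_path C x y e g.
Proof.
move=> gC g0 g1 hg hw wc we; split=> //; exists setT, h.
have Dh : (fun t => 'D_1 h t) = w by apply/funext => t; apply: derive_val.
split=> //; first exact: openT.
- split=> [t _|t _]; last by rewrite Dh; exact: wc.
  by have := hw t; case.
- by move=> t _; have := we t; rewrite -Dh.
Qed.

End C1Extension.

(** * Length of nearly straight curves and intrinsic distance *)

Section Length.
Context {R : realType} {n : nat}.
Implicit Types (g h : R -> 'rV[R]_n) (C : set 'rV[R]_n) (x y : 'rV[R]_n).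

Lemma partition_mono (t : nat -> R) k : (forall i, (i < k)%N -> t i <= t i.+1) ->
  forall i j, (i <= j)%N -> (j <= k)%N -> t i <= t j.
Proof.
move=> tm i; elim=> [|j IH]; first by rewrite leqn0 => /eqP ->.
rewrite leq_eqVlt => /orP[/eqP -> //|ij] jk.
by rewrite (le_trans (IH ij (ltnW jk))) // tm.
Qed.

(* With [S^2 = |u|^2 + K^2], each chord satisfies
   [S |h b - h a| <= f b - f a] for [f s = s S^2 + <u, h s> - s |u|^2]. *)
Lemma curve_length_le h (K : R) : 0 <= K ->
  (forall a b, 0 <= a -> a <= b -> b <= 1 ->
     enorm (h b - h a - (b - a) *: (h 1 - h 0)) <= K * (b - a)) ->
  (curve_length h <= (Num.sqrt (enorm (h 1 - h 0) ^+ 2 + K ^+ 2))%:E)%E.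
Proof.
move=> K0 hK; set u := h 1 - h 0 in hK *.
have uE : u = h 1 - h 0 by []; clearbody u.
set S := Num.sqrt _.
have SE : S ^+ 2 = enorm u ^+ 2 + K ^+ 2 by rewrite sqr_sqrtr // addr_ge0 ?sqr_ge0.
have S0 : 0 <= S by exact: sqrtr_ge0.
pose f s := s * S ^+ 2 + dotp u (h s) - s * enorm u ^+ 2.
have chord a b : 0 <= a -> a <= b -> b <= 1 -> S * enorm (h b - h a) <= f b - f a.
  move=> a0 ab b1; have := hK a b a0 ab b1.
  set w := _ - _ *: u => wK.
  have hE : h b - h a = (b - a) *: u + w by rewrite /w [RHS]addrC subrK.
  have fE : f b - f a = (b - a) * S ^+ 2 + dotp u w.
    by rewrite /w dotpDr dotpNr dotpZr !dotpDr dotpNr -enorm_sqr /f; ring.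
  clearbody w; have w0 := enorm_ge0 w; have u0 := enorm_ge0 u; have ba : 0 <= b - a by rewrite subr_ge0.
  have uw : - (enorm u * enorm w) <= dotp u w.
    by rewrite -[leRHS]opprK -dotpNl lerN2 -(enormN u) dotp_le.
  have ww : enorm w ^+ 2 <= (K * (b - a)) ^+ 2 by rewrite ler_pXn2r ?nnegrE ?mulr_ge0.
  have rhs0 : 0 <= (b - a) * S ^+ 2 + dotp u w.
    have : enorm u * enorm w <= enorm u * (K * (b - a)) by rewrite ler_wpM2l.
    have : (b - a) * (enorm u * K) <= (b - a) * S ^+ 2.
      by rewrite ler_wpM2l // SE; have := sqr_ge0 (enorm u - K); nra.
    lra.
  (* After squaring, the right side minus the left is [S^2 (K^2 (b - a)^2 - |w|^2) + <u, w>^2]. *)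
  rewrite fE -(ler_pXn2r (n := 2)) ?nnegrE ?mulr_ge0 ?enorm_ge0 //.
  rewrite exprMn [enorm (h b - h a) ^+ 2]enorm_sqr hE !dotpE (dotpC w u) -!enorm_sqr.
  set d := dotp u w.
  have : S ^+ 2 * enorm w ^+ 2 <= S ^+ 2 * (K * (b - a)) ^+ 2 by rewrite ler_wpM2l ?sqr_ge0.
  rewrite (exprMn _ K).
  have -> : K ^+ 2 = S ^+ 2 - enorm u ^+ 2 by rewrite SE; ring.
  by have := sqr_ge0 d; lra.
apply: ge_ereal_sup => _ [k [t [t0 tk tm ->]]]; rewrite lee_fin.
have tmono := partition_mono t k tm.
(* The chord bounds telescope to [f 1 - f 0], which is [S^2] because [u = h 1 - h 0]. *)
have total : S * \sum_(i < k) enorm (h (t i.+1) - h (t i)) <= S ^+ 2.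
  apply: (@le_trans _ _ (\sum_(i < k) (f (t i.+1) - f (t i)))).
    rewrite mulr_sumr; apply: ler_sum => i _; apply: chord.
    - by rewrite -t0 tmono // ltnW.
    - by rewrite tm.
    - by rewrite -tk tmono.
  rewrite -(big_mkord xpredT (fun i => f (t i.+1) - f (t i))).
  rewrite (telescope_sumr (fun i => f (t i))) // t0 tk /f enorm_sqr.
  have : dotp u u = dotp u (h 1) - dotp u (h 0) by rewrite {2}uE dotpDr dotpNr.
  by lra.
(* [S] cannot be cancelled when it is zero, but then [u] and [K] vanish and so does every chord. *)
have [S00|Sn] := eqVneq S 0; last first.
  by move: total; rewrite expr2 ler_pM2l // lt_neqAle eq_sym Sn.
rewrite S00; apply: sumr_le0 => i _.
have /andP[a0 b1] : 0 <= t i <= 1 by rewrite -{1}t0 -tk !tmono // ltnW.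
have b1' : t i.+1 <= 1 by rewrite -tk tmono.
have := hK _ _ a0 (tm i (ltn_ord i)) b1'.
have := SE; rewrite S00 expr0n /= => /esym/eqP.
rewrite paddr_eq0 ?sqr_ge0 // !sqrf_eq0 => /andP[/eqP /enorm_eq0 -> /eqP ->].
by rewrite scaler0 subr0 mul0r.
Qed.

(** The partition with a single interval already gives the chord. *)
Lemma intrinsic_dist_ge C x y : ((enorm (y - x))%:E <= intrinsic_dist C x y)%E.
Proof.
apply: le_ereal_inf_tmp => _ [g [_ _ g0 g1] <-].
apply: ereal_sup_ubound; exists 1%N, (fun i => i%:R); split=> //.
- by case.
- by rewrite big_ord1 g0 g1.
Qed.

End Length.

(** * Paths in a prox-regular set *)

Section LocalGeometry.
Context {R : realType} {n : nat} (C : set 'rV[R]_n) (xb : 'rV[R]_n) (r k : R).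
Hypothesis k_gt0 : 0 < k.
Let K := C `&` ecball xb r.
Hypothesis K_closed : closed K.
Hypothesis K_prox : forall x y v, K x -> K y -> reg_normal_cone C x v ->
  dotp v (y - x) <= k * enorm v * enorm (y - x) ^+ 2.

Let K_compact : compact K.
Proof. by apply: (compact_ecball K xb r K_closed) => y []. Qed.

(* [y] is a point of [K] nearest to the midpoint [m] of [a] and [b], so [m - y]
   is a regular normal at [y]; test it against [a] and [b]. *)
Lemma nearest_midpoint a b y : K a -> K b -> K y -> enorm (y - xb) < r ->
  (forall z, K z -> enorm (a - y) ^+ 2 + enorm (b - y) ^+ 2 <=
                    enorm (a - z) ^+ 2 + enorm (b - z) ^+ 2) ->
  enorm (a + b - 2 *: y) <= k * (enorm (a - y) ^+ 2 + enorm (b - y) ^+ 2).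
Proof.
move=> Ka Kb Ky yr ymin; set v := a + b - 2 *: y.
have vN : reg_normal_cone C y v.
  (* The second bound keeps the test points in the ball, hence in [K], where [y] is minimal. *)
  move=> e e0; exists (Num.min e (r - enorm (y - xb))).
    by rewrite lt_min e0; lra.
  move=> z Cz; rewrite lt_min => /andP[ze zr].
  have /ymin : K z.
    by split=> //; rewrite /ecball /=; have := enorm_sub_trans y z xb; lra.
  (* After this expansion minimality reads [<v, z - y> <= |z - y|^2], which suffices since
     [|z - y| < e]. *)
  have -> : enorm (a - z) ^+ 2 + enorm (b - z) ^+ 2 =
      enorm (a - y) ^+ 2 + enorm (b - y) ^+ 2 + 2 * enorm (z - y) ^+ 2 - 2 * dotp v (z - y).
    rewrite !enorm_sqr /v !dotpE (dotpC z a) (dotpC z b) (dotpC y a) (dotpC y b) (dotpC z y); ring.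
  have := enorm_ge0 (z - y); nra.
have [v0|v0] := eqVneq (enorm v) 0.
  by rewrite v0 mulr_ge0 ?addr_ge0 ?sqr_ge0 // ltW.
have vp : 0 < enorm v by rewrite lt_neqAle eq_sym v0 enorm_ge0.
rewrite -(ler_pM2l vp) -expr2 (enorm_sqr v).
have -> : dotp v v = dotp v (a - y) + dotp v (b - y).
  by rewrite -dotpDr /v scaler_nat mulr2n opprD addrACA.
have := K_prox _ _ _ Ky Ka vN; have := K_prox _ _ _ Ky Kb vN; lra.
Qed.

Lemma min_chain_second_diff N x y X i : min_chain K N x y X -> (i.+1 < N)%N ->
  enorm (X i.+1 - xb) < r ->
  enorm (X i + X i.+2 - 2 *: X i.+1) <=
    k * (enorm (X i.+1 - X i) ^+ 2 + enorm (X i.+2 - X i.+1) ^+ 2).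
Proof.
move=> Xm iN Xr; rewrite (enormB _ (X i)); have [[_ _ XK] _] := Xm.
by apply: nearest_midpoint => // z Kz; exact: min_chain_local Xm iN Kz.
Qed.

(** * Energy-minimising chains between two nearby points *)

Section Steps.
Variables x y : 'rV[R]_n.
Let u := y - x.
Hypotheses (Cx : C x) (Cy : C y).
Hypothesis u_gt0 : 0 < enorm u.
Hypothesis near_r : enorm (x - xb) + 4 * enorm u < r.
Hypothesis small_u : 4 * k * enorm u <= 1.

Let Kx : K x.
Proof. by split=> //; rewrite /ecball /=; move: u_gt0 near_r; lra. Qed.

Let Ky : K y.
Proof.
split=> //; rewrite /ecball /=.
by move: u_gt0 near_r (enorm_sub_trans x y xb); rewrite -/u; lra.
Qed.

(** The length of the chain is controlled by [N] times its energy; Cauchy-Schwarz is applied in the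
    form of a termwise AM-GM inequality. *)
Lemma min_chain_near N X i : min_chain K N x y X -> (0 < N)%N ->
  N%:R * energy N X <= 2 * enorm u ^+ 2 -> (i <= N)%N ->
  enorm (X i - x) <= 2 * enorm u.
Proof.
move=> [[X0 XN XK] _] N0 eN iN.
apply: (@le_trans _ _ (\sum_(l < N) enorm (X l.+1 - X l))).
  rewrite -X0; apply: le_trans (chain_dist _ _ _ (leq0n i)) _.
  by apply: sumr_sub_range => // l; exact: enorm_ge0.
have N0' : 0 < N%:R :> R by rewrite ltr0n.
rewrite -(ler_pM2l (mulr_gt0 N0' u_gt0)) mulr_sumr.
apply: (@le_trans _ _ (\sum_(l < N) (enorm u ^+ 2 + N%:R ^+ 2 * enorm (X l.+1 - X l) ^+ 2) / 2)).
  apply: ler_sum => l _.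
  by have := sqr_ge0 (enorm u - N%:R * enorm (X l.+1 - X l)); lra.
rewrite -mulr_suml big_split /= sumr_const card_ord -mulr_sumr -/(energy N X).
rewrite -[enorm u ^+ 2 *+ N]mulr_natl.
have := mulr_ge0 (ltW N0') (sqr_ge0 (enorm u)).
by move: eN; rewrite -(ler_pM2l N0'); lra.
Qed.

(** The energy controls the steps only on average. By the second difference bound two steps differ
    by at most [2 k] times the energy, hence by [4 k |u|^2 / N <= |u| / N], so every scaled step is
    within [|u|] of the mean [u]. *)
Lemma min_chain_step N X i : min_chain K N x y X -> (0 < N)%N ->
  N%:R * energy N X <= 2 * enorm u ^+ 2 -> (i < N)%N ->
  N%:R * enorm (X i.+1 - X i) <= 2 * enorm u.
Proof.
move=> Xm N0 eN iN.
have N0' : 0 < N%:R :> R by rewrite ltr0n.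
have Xr l : (l <= N)%N -> enorm (X l - xb) < r.
  move=> /(min_chain_near _ _ _ Xm N0 eN) Xl.
  by move: u_gt0 near_r (enorm_sub_trans x (X l) xb); lra.
pose v l := X l.+1 - X l.
have dev a b : (a <= b)%N -> (b < N)%N -> enorm (v b - v a) <= enorm u / N%:R.
  move=> ab bN; apply: le_trans (chain_dist _ _ _ ab) _.
  apply: (@le_trans _ _ (\sum_(a <= l < b) (k * (enorm (v l) ^+ 2 + enorm (v l.+1) ^+ 2)))).
    apply: ler_sum_nat => l /andP[_ lb]; rewrite /v second_diffE.
    have lN : (l.+1 < N)%N by exact: leq_ltn_trans lb bN.
    exact: min_chain_second_diff Xm lN (Xr _ (ltnW lN)).
  rewrite -mulr_sumr big_split /=.
  have := sumr_sub_range (fun l => enorm (v l) ^+ 2) N a b (fun l => sqr_ge0 _) ab (ltnW bN).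
  have := sumr_sub_range (fun l => enorm (v l) ^+ 2) N a.+1 b.+1 (fun l => sqr_ge0 _) ab bN.
  rewrite big_add1 /= -/(energy N X) => s1 s2.
  rewrite ler_pdivlMr //.
  have ke : k * (N%:R * energy N X) <= k * (2 * enorm u ^+ 2) by rewrite ler_pM2l.
  have sE : k * (\sum_(a <= i0 < b) enorm (v i0) ^+ 2 + \sum_(a <= i0 < b) enorm (v i0.+1) ^+ 2) * N%:R
      <= k * (energy N X + energy N X) * N%:R.
    by rewrite ler_pM2r // ler_pM2l // lerD.
  by move: small_u; rewrite -(ler_pM2r u_gt0); lra.
have [X0 XN _] := Xm.1.
have H : enorm (N%:R *: (X i.+1 - X i) - u) <= enorm u.
  rewrite -[leRHS](divfK (lt0r_neq0 N0')) mulrC /u -{1}X0 -{1}XN.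
  apply: step_mean_dev => j jN; have [ij|/ltnW ji] := leqP i j; last exact: dev.
  by rewrite enormB; exact: dev.
have -> : N%:R * enorm (X i.+1 - X i) = enorm (N%:R *: (X i.+1 - X i)).
  by rewrite enormZ normr_nat.
by rewrite -[X in enorm X](subrK u) (le_trans (enormD _ _)) //; lra.
Qed.

(** Inserting [p] between [a] and [b] gives [2 (|p - a|^2 + |b - p|^2) = |b - a|^2 + |a + b - 2
    p|^2], and the last term is at most [|b - a|^2 / (4 N^2)]. *)
Lemma refine_chain N X : min_chain K N x y X -> (0 < N)%N ->
  N%:R * energy N X <= 2 * enorm u ^+ 2 ->
  exists2 Z, chain K N.*2 x y Z &
    2 * N%:R * energy N.*2 Z <= N%:R * energy N X + enorm u ^+ 2 / (2 * N%:R).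
Proof.
move=> Xm N0 eN; have [[X0 XN XK] _] := Xm.
have N1 : 1 <= N%:R :> R by rewrite ler1n.
have N0' : 0 < N%:R :> R by lra.
have /choice [P HP] i : exists P, min_chain K 2 (X i) (X i.+1) P.
  exact: ex_min_chain.
pose Z m := if odd m then P m./2 1%N else X m./2.
have Ze i : Z i.*2 = X i by rewrite /Z odd_double doubleK.
have Zo i : Z i.*2.+1 = P i 1%N by rewrite /Z /= odd_double /= uphalf_double.
exists Z.
  split; [by rewrite -X0 -(Ze 0%N)|by rewrite Ze|move=> m; rewrite /Z].
  by case: ifP => _ //; have [[_ _]] := HP m./2.
have stepE i : (i < N)%N -> 2 * N%:R * (enorm (Z i.*2.+1 - Z i.*2) ^+ 2 +
    enorm (Z i.*2.+2 - Z i.*2.+1) ^+ 2) <=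
    N%:R * enorm (X i.+1 - X i) ^+ 2 + enorm (X i.+1 - X i) ^+ 2 / (4 * N%:R).
  move=> iN; rewrite -doubleS Zo !Ze.
  have Xstep := min_chain_step _ _ _ Xm N0 eN iN.
  have Xi := min_chain_near _ _ _ Xm N0 eN (ltnW iN).
  have [[P0 P2 PK] Pmin] := HP i.
  (* The chain that waits at [X i] and then jumps to [X i.+1] is a competitor. *)
  have Pa : enorm (P i 1%N - X i) ^+ 2 + enorm (X i.+1 - P i 1%N) ^+ 2 <=
      enorm (X i.+1 - X i) ^+ 2.
    have /Pmin : chain K 2 (X i) (X i.+1) (fun m => if (m <= 1)%N then X i else X i.+1).
      by split=> // m; case: ifP.
    rewrite /energy !big_ord_recr !big_ord0 /= P0 P2 subrr enorm0 expr0n !add0r //.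
  set a := X i in Pa Xstep Xi P0 *; set b := X i.+1 in Pa Xstep P2 *.
  set p := P i 1%N in Pa *.
  have step2 : enorm (b - a) <= 2 * enorm u.
    by have := enorm_ge0 (b - a); nra.
  have pa : enorm (p - a) <= enorm (b - a).
    rewrite -(ler_pXn2r (n := 2)) ?nnegrE ?enorm_ge0 //.
    by have := sqr_ge0 (enorm (b - p)); lra.
  (* The whole margin [4 |u|] is used: [2 |u|] from [x] to [a] and [2 |u|] from [a] to [p]. *)
  have pr : enorm (p - xb) < r.
    by move: near_r (enorm_sub_trans a p xb) (enorm_sub_trans x a xb); lra.
  have := min_chain_second_diff _ _ _ _ 0 (HP i) isT pr.
  rewrite P0 P2 -/p => D.
  have {}D : enorm (a + b - 2 *: p) <= k * enorm (b - a) ^+ 2.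
    by apply: le_trans D _; rewrite ler_pM2l.
  have := parallelogram a b p; rewrite (enormB a p) => Dp.
  have ND : 2 * N%:R * enorm (a + b - 2 *: p) <= enorm (b - a).
    apply: (@le_trans _ _ (2 * N%:R * (k * enorm (b - a) ^+ 2))).
      by rewrite ler_pM2l ?mulr_gt0.
    have ab0 := enorm_ge0 (b - a).
    apply: (@le_trans _ _ (4 * k * enorm u * enorm (b - a))); last first.
      by rewrite ler_piMl.
    rewrite expr2 !mulrA ler_wpM2r //.
    by have := ler_wpM2l (ltW k_gt0) Xstep; lra.
  have {}ND : 4 * N%:R ^+ 2 * enorm (a + b - 2 *: p) ^+ 2 <= enorm (b - a) ^+ 2.
    rewrite (_ : _ * _ = (2 * N%:R * enorm (a + b - 2 *: p)) ^+ 2); last by ring.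
    by rewrite ler_pXn2r ?nnegrE ?mulr_ge0 ?enorm_ge0.
  rewrite mulrAC -Dp mulrDl [leLHS]addrC mulrC lerD2l ler_pdivlMr ?mulr_gt0 //.
  by lra.
rewrite energy_double mulr_sumr.
apply: le_trans (ler_sum _ (fun (i : 'I_N) _ => stepE i (ltn_ord i))) _.
rewrite big_split /= -mulr_sumr -mulr_suml -/(energy N X) lerD2l.
rewrite ler_pdivrMr ?mulr_gt0 //.
have -> : enorm u ^+ 2 / (2 * N%:R) * (4 * N%:R) = 2 * enorm u ^+ 2.
  by field; rewrite gt_eqF.
by have := energy_ge0 N X; nra.
Qed.

(** The excesses [|u|^2 / (2 N)] of successive refinements form a geometric series with partial sums
    [2 - 2^-j], so [N] times the energy stays below [2 |u|^2]. *)
Lemma dyadic_min_chain j : exists2 X, min_chain K (2 ^ j) x y X &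
  (2 ^ j)%:R * energy (2 ^ j) X <= enorm u ^+ 2 * (2 - (2 ^ j)%:R^-1).
Proof.
elim: j => [|j [X Xm eX]].
  have [X Xm] := ex_min_chain K 1 x y K_compact Kx Ky isT.
  exists X => //; have [[X0 X1 _] _] := Xm.
  by rewrite expn0 /energy big_ord1 X0 X1 -/u invr1; lra.
have N0 : (0 < 2 ^ j)%N by rewrite expn_gt0.
have N0' : 0 < (2 ^ j)%:R :> R by rewrite ltr0n.
have eX2 : (2 ^ j)%:R * energy (2 ^ j) X <= 2 * enorm u ^+ 2.
  apply: le_trans eX _.
  have : 0 <= (2 ^ j)%:R^-1 :> R by rewrite invr_ge0 ltW.
  by have := sqr_ge0 (enorm u); nra.
have [Z cZ eZ] := refine_chain _ _ Xm N0 eX2.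
(* The refined chain need not be minimal; it only bounds the energy of a minimiser of the next
   level. *)
have [Y Ym] : exists Y, min_chain K (2 ^ j.+1) x y Y.
  by apply: ex_min_chain => //; rewrite expn_gt0.
exists Y => //; have [_ /(_ Z)] := Ym.
have -> : (2 ^ j.+1 = (2 ^ j).*2)%N by rewrite expnS mul2n.
move=> /(_ cZ) YZ; rewrite -mul2n natrM.
apply: (@le_trans _ _ (2 * (2 ^ j)%:R * energy (2 ^ j).*2 Z)).
  by rewrite mul2n ler_pM2l // mulr_gt0.
apply: le_trans eZ _; rewrite !invfM.
by move: (2 ^ j)%:R^-1 eX => c; lra.
Qed.

Lemma dyadic_chain j : exists2 X, chain K (2 ^ j) x y X &
  forall i, (i.+1 < 2 ^ j)%N ->
    enorm (X i + X i.+2 - 2 *: X i.+1) <= 8 * k * enorm u ^+ 2 / (2 ^ j)%:R ^+ 2.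
Proof.
have [X Xm eX] := dyadic_min_chain j; exists X; first by case: Xm.
have N0 : (0 < 2 ^ j)%N by rewrite expn_gt0.
have N0' : 0 < (2 ^ j)%:R :> R by rewrite ltr0n.
have eX2 : (2 ^ j)%:R * energy (2 ^ j) X <= 2 * enorm u ^+ 2.
  apply: le_trans eX _.
  have : 0 <= (2 ^ j)%:R^-1 :> R by rewrite invr_ge0 ltW.
  by have := sqr_ge0 (enorm u); nra.
move=> i iN.
have Xr : enorm (X i.+1 - xb) < r.
  have := min_chain_near _ _ _ Xm N0 eX2 (ltnW iN).
  by move: u_gt0 near_r (enorm_sub_trans x (X i.+1) xb); lra.
have := min_chain_second_diff _ _ _ _ _ Xm iN Xr.
rewrite ler_pdivlMr ?exprn_gt0 // -(ler_pM2r (exprn_gt0 2 N0')) => /le_trans; apply.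
(* Both adjacent steps are at most [2 |u| / N], whence [8 k = k (4 + 4)]. *)
have sq l : (l < 2 ^ j)%N -> ((2 ^ j)%:R * enorm (X l.+1 - X l)) ^+ 2 <= (2 * enorm u) ^+ 2.
  move=> lN; rewrite ler_pXn2r ?nnegrE ?mulr_ge0 ?enorm_ge0 //.
  exact: min_chain_step Xm N0 eX2 lN.
have := ler_wpM2l (ltW k_gt0) (lerD (sq i (ltnW iN)) (sq i.+1 iN)); lra.
Qed.

End Steps.

Lemma smooth_path x y : C x -> C y -> enorm (x - xb) + 4 * enorm (y - x) < r ->
  4 * k * enorm (y - x) <= 1 -> exists h w, [/\
    [/\ forall t, 0 <= t <= 1 -> C (h t), h 0 = x & h 1 = y],
    (forall t : R, is_derive t (1 : R) h (w t)), continuous w,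
    (forall t, enorm (w t - (y - x)) <= 8 * k * enorm (y - x) ^+ 2) &
    (forall a b, 0 <= a -> a <= b -> b <= 1 ->
       enorm (h b - h a - (b - a) *: (y - x)) <= 8 * k * enorm (y - x) ^+ 2 * (b - a))].
Proof.
move=> Cx Cy near_r small_u.
have [u0|un] := eqVneq (enorm (y - x)) 0.
  have yx := enorm_eq0 _ u0; exists (fun=> x), (fun=> 0); split.
  - by split=> //; rewrite -[y](subrK x) yx add0r.
  - by move=> t; exact: is_derive_cst.
  - by move=> t; exact: cvg_cst.
  - by move=> t; rewrite yx subr0 enorm0 expr0n /= mulr0.
  - by move=> a b _ _ _; rewrite yx scaler0 subrr subr0 enorm0 expr0n /= mulr0 mul0r.
have u0 : 0 < enorm (y - x) by rewrite lt_neqAle eq_sym un enorm_ge0.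
have /choice [X HX] j : exists X, chain K (2 ^ j) x y X /\
    forall i, (i.+1 < 2 ^ j)%N -> enorm (X i + X i.+2 - 2 *: X i.+1) <=
      8 * k * enorm (y - x) ^+ 2 / (2 ^ j)%:R ^+ 2.
  have [X cX X2] := dyadic_chain x y Cx Cy u0 near_r small_u j.
  by exists X.
have X0 j : X j 0%N = x by have [[]] := HX j.
have XN j : X j (2 ^ j)%N = y by have [[]] := HX j.
have XK j i : K (X j i) by have [[]] := HX j.
have X2 j := (HX j).2.
have M0 : 0 <= 8 * k * enorm (y - x) ^+ 2 by rewrite mulr_ge0 ?sqr_ge0 // mulr_ge0 // ltW.
have [F [FU Foo]] := free_ultrafilter.
have [g [w [gl wu wL gu gw]]] := dyadic_limit_segment F FU Foo X x y _ M0 X0 XN X2.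
have [h [hg hw wc]] := C1_extension g w _ M0 wL gw.
(* At times 0 and 1 the node is the same endpoint for every [j], which fixes the ends of the
   limit. *)
have glim t l : 0 <= t <= 1 -> (forall j, X j (Num.truncn (t * (2 ^ j)%:R)) = l) -> g t = l.
  move=> t01 Xl; have := gl t t01.
  rewrite (_ : (fun j => _) = (fun=> l)); last exact/funext.
  by move=> /(cvg_unique (@norm_hausdorff _ _)); apply; exact: cvg_cst.
exists h, (w \o clamp01); split=> //.
- split.
  + move=> t t01; rewrite hg //; suff [] : K (g t) by [].
    by apply: (closed_cvg K K_closed _ _ (gl t t01)); apply: filterE => j; exact: XK.
  + by rewrite hg ?lexx ?ler01 //; apply: glim => [|j]; rewrite ?lexx ?ler01 // mul0r truncn0.
  + by rewrite hg ?lexx ?ler01 //; apply: glim => [|j]; rewrite ?lexx ?ler01 // mul1r natrK.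
- by move=> t; exact: wu (clamp01_itv t).
- by move=> a b a0 ab b1; rewrite !hg; [exact: gu|lra|lra].
Qed.

(** The velocity of the smooth path deviates from [y - x] by a quadratic amount, so the excess under
    the root is of fourth order. *)
Lemma intrinsic_dist_le x y : C x -> C y -> enorm (x - xb) + 4 * enorm (y - x) < r ->
  4 * k * enorm (y - x) <= 1 ->
  (intrinsic_dist C x y <=
    (Num.sqrt (enorm (y - x) ^+ 2 + (8 * k * enorm (y - x) ^+ 2) ^+ 2))%:E)%E.
Proof.
move=> Cx Cy near_r small_u.
have [h [w [[hC h0 h1] hw wc _ hu]]] := smooth_path x y Cx Cy near_r small_u.
have M0 : 0 <= 8 * k * enorm (y - x) ^+ 2 by rewrite mulr_ge0 ?sqr_ge0 // mulr_ge0 // ltW.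
apply: ge_ereal_inf; exists (curve_length h).
  exists h => //; split=> //; apply: continuous_subspaceT => t.
  by apply: differentiable_continuous; apply/derivable1_diffP; case: (hw t).
have := curve_length_le h _ M0; rewrite h0 h1; exact.
Qed.

(** * Averaging maps *)

Section Averaging.
Variables (d : R) (x y : 'rV[R]_n) (g : R -> 'rV[R]_n).
Hypotheses (d_r : 32 * d <= r) (d_k : 32 * k * d <= 1).
Hypotheses (Cx : C x) (Cy : C y) (xd : enorm (x - xb) < d) (yd : enorm (y - xb) < d).
Hypothesis g_avg : averaging_map C x y g.

Let u2d : enorm (y - x) < 2 * d.
Proof. by move: xd yd (enorm_sub_trans xb y x); rewrite (enormB xb x); lra. Qed.

Let d_gt0 : 0 < d.
Proof. exact: le_lt_trans (enorm_ge0 _) xd. Qed.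

(** [L] is the intrinsic distance from [x] to [y], finite because of the smooth path; it is the
    constant intrinsic speed of [g] and dominates the Euclidean one. *)
Lemma averaging_lipschitz : exists L : R, [/\ 0 <= L, L <= 3 * enorm (y - x),
  forall s t, 0 <= s <= 1 -> 0 <= t <= 1 ->
    intrinsic_dist C (g s) (g t) = (`|s - t| * L)%:E &
  forall s t, 0 <= s <= 1 -> 0 <= t <= 1 -> enorm (g t - g s) <= `|s - t| * L].
Proof.
have u0 := enorm_ge0 (y - x).
have near_r : enorm (x - xb) + 4 * enorm (y - x) < r by move: d_r u2d xd d_gt0; lra.
have small_u : 4 * k * enorm (y - x) <= 1.
  have : k * enorm (y - x) <= k * (2 * d) by rewrite ler_pM2l // ltW.
  by move: d_k (mulr_gt0 k_gt0 d_gt0); lra.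
have := intrinsic_dist_le x y Cx Cy near_r small_u.
have := intrinsic_dist_ge C x y.
case: g_avg => _ _ _.
case: (intrinsic_dist C x y) => [L|//|//]; rewrite !lee_fin => gL uL Lu.
have L0 : 0 <= L by exact: le_trans uL.
exists L; split=> //.
(* Since [8 k |u|^2 <= 2 |u|] for [u = y - x], the quantity under the root is at most
   [5 |u|^2 <= (3 |u|)^2]. *)
- apply: le_trans Lu _; rewrite -(ler_pXn2r (n := 2)) ?nnegrE ?sqrtr_ge0 ?mulr_ge0 //.
  rewrite sqr_sqrtr ?addr_ge0 ?sqr_ge0 //.
  have : 8 * k * enorm (y - x) ^+ 2 <= 2 * enorm (y - x).
    by have := ler_wpM2r u0 small_u; lra.
  have : 0 <= 8 * k * enorm (y - x) ^+ 2 by rewrite mulr_ge0 ?sqr_ge0 // mulr_ge0 // ltW.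
  move: (8 * k * _ ^+ 2) => M; nra.
- move=> s t s01 t01; rewrite -lee_fin EFinM -(gL s t s01 t01).
  exact: intrinsic_dist_ge.
Qed.

(** Both outer points are within [t L] of the middle one, while their intrinsic distance is [2 t L].
    As its square exceeds the squared chord by a quartic term only, the parallelogram identity
    bounds the squared second difference by that term. *)
Lemma averaging_second_diff (s t : R) : 0 <= s -> 0 <= t -> s + 2 * t <= 1 ->
  enorm (g s + g (s + 2 * t) - 2 *: g (s + t)) <= 9 * (32 * k) * enorm (y - x) ^+ 2 * t ^+ 2.
Proof.
move=> s0 t0 st1; have [L [L0 Lu dL gL]] := averaging_lipschitz.
have [gC g0 g1 _] := g_avg; have u0 := enorm_ge0 (y - x).
have s01 : 0 <= s <= 1 by lra.
have m01 : 0 <= s + t <= 1 by lra.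
have b01 : 0 <= s + 2 * t <= 1 by lra.
have z01 : 0 <= (0 : R) <= 1 by lra.
have am := gL _ _ s01 m01; have bm := gL _ _ m01 b01; have ab := gL _ _ s01 b01.
rewrite (_ : s - (s + t) = - t) in am; last by ring.
rewrite (_ : s + t - (s + 2 * t) = - t) in bm; last by ring.
rewrite (_ : s - (s + 2 * t) = - (2 * t)) in ab; last by ring.
have dab := dL _ _ s01 b01.
rewrite (_ : s - (s + 2 * t) = - (2 * t)) in dab; last by ring.
rewrite !normrN !(ger0_norm t0) in am bm.
have t20 : 0 <= 2 * t by rewrite mulr_ge0.
rewrite normrN (ger0_norm t20) in ab dab.
have gs : enorm (g s - x) <= 3 * enorm (y - x).
  have := gL _ _ z01 s01; rewrite g0 sub0r normrN ger0_norm // => /le_trans; apply.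
  by apply: le_trans Lu; rewrite ler_piMl //; lra.
set A := g s in am ab dab gs *; set B := g (s + 2 * t) in bm ab dab *.
set m := g (s + t) in am bm *.
have AB : enorm (B - A) <= 3 * enorm (y - x).
  by apply: le_trans ab _; apply: le_trans Lu; rewrite ler_piMl //; lra.
(* [|A - xb| < 7 d] and [|B - A| < 6 d], so the conditions on [32 d] and [32 k d] leave enough
   room. *)
have near_r : enorm (A - xb) + 4 * enorm (B - A) < r.
  by move: d_r u2d xd d_gt0 (enorm_sub_trans x A xb); lra.
have small_u : 4 * k * enorm (B - A) <= 1.
  have : k * enorm (B - A) <= k * (6 * d).
    by rewrite ler_pM2l //; move: u2d AB; lra.
  by move: d_k (mulr_gt0 k_gt0 d_gt0); lra.
have := intrinsic_dist_le A B (gC _ s01) (gC _ b01) near_r small_u.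
rewrite dab lee_fin -(ler_pXn2r (n := 2)) ?nnegrE ?sqrtr_ge0 ?mulr_ge0 //.
rewrite sqr_sqrtr ?addr_ge0 ?sqr_ge0 // => dAB.
have am2 : enorm (A - m) ^+ 2 <= (t * L) ^+ 2.
  by rewrite enormB ler_pXn2r ?nnegrE ?enorm_ge0 ?mulr_ge0.
have bm2 : enorm (B - m) ^+ 2 <= (t * L) ^+ 2.
  by rewrite ler_pXn2r ?nnegrE ?enorm_ge0 ?mulr_ge0.
have ab2 : enorm (B - A) ^+ 2 <= (2 * t * L) ^+ 2.
  by rewrite ler_pXn2r ?nnegrE ?enorm_ge0 ?mulr_ge0.
have D2 : enorm (A + B - 2 *: m) ^+ 2 <= (8 * k * enorm (B - A) ^+ 2) ^+ 2.
  have := parallelogram A B m; move: dAB am2 bm2; lra.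
have M0 : 0 <= 8 * k * enorm (B - A) ^+ 2 by rewrite mulr_ge0 ?sqr_ge0 // mulr_ge0 // ltW.
rewrite ler_pXn2r ?nnegrE ?enorm_ge0 // in D2.
apply: le_trans D2 _.
(* [|B - A| <= 2 t L] and [L <= 3 |y - x|] turn [8 k |B - A|^2] into the stated bound. *)
have L2 : L ^+ 2 <= 9 * enorm (y - x) ^+ 2.
  by rewrite (_ : 9 * _ = (3 * enorm (y - x)) ^+ 2); [rewrite ler_pXn2r ?nnegrE ?mulr_ge0|ring].
have kp : 0 <= 32 * k * t ^+ 2 by rewrite mulr_ge0 ?sqr_ge0 // mulr_ge0 // ltW.
have k8 : 0 <= 8 * k by rewrite mulr_ge0 // ltW.
by have := ler_wpM2l kp L2; have := ler_wpM2l k8 ab2; lra.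
Qed.

Lemma averaging_eps_path (e : R) : 9 * (32 * k) * enorm (y - x) <= e -> eps_path C x y e g.
Proof.
move=> ke; have [L [L0 Lu _ gL]] := averaging_lipschitz.
have [gC g0 g1 _] := g_avg; have u0 := enorm_ge0 (y - x).
pose X j i := g (i%:R / (2 ^ j)%:R).
have N0 j : 0 < (2 ^ j)%:R :> R by rewrite ltr0n expn_gt0.
have M0 : 0 <= 9 * (32 * k) * enorm (y - x) ^+ 2 by rewrite mulr_ge0 ?sqr_ge0 // !mulr_ge0 // ltW.
have X0 j : X j 0%N = x by rewrite /X mul0r.
have XN j : X j (2 ^ j)%N = y by rewrite /X divff ?gt_eqF.
have X2 j i : (i.+1 < 2 ^ j)%N -> enorm (X j i + X j i.+2 - 2 *: X j i.+1) <=
    9 * (32 * k) * enorm (y - x) ^+ 2 / (2 ^ j)%:R ^+ 2.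
  move=> ij; rewrite -exprVn.
  have := averaging_second_diff (i%:R / (2 ^ j)%:R) (2 ^ j)%:R^-1.
  have -> : i%:R / (2 ^ j)%:R + 2 * (2 ^ j)%:R^-1 = i.+2%:R / (2 ^ j)%:R :> R.
    by rewrite -mulrDl -natrD addn2.
  have -> : i%:R / (2 ^ j)%:R + (2 ^ j)%:R^-1 = i.+1%:R / (2 ^ j)%:R :> R.
    by rewrite -[X in _ + X]mul1r -mulrDl natr1.
  apply; first by rewrite divr_ge0 // ltW.
    by rewrite invr_ge0 ltW.
  by rewrite ler_pdivrMr // mul1r ler_nat.
have [F [FU Foo]] := free_ultrafilter.
have [g' [w [gl wu wL gu gw]]] := dyadic_limit_segment F FU Foo X x y _ M0 X0 XN X2.
have [h [hg hw wc]] := C1_extension g' w _ M0 wL gw.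
(* The chains are samples of [g], so its Lipschitz continuity identifies their limit with [g], which
   thus inherits the derivative. *)
have gg' t : 0 <= t <= 1 -> g' t = g t.
  move=> t01; apply: (cvg_unique (@norm_hausdorff _ _) (gl t t01)).
  apply/cvg_enormP => e' e0; have M1 : 0 < L + 1 by rewrite ltr_wpDl.
  have := cvg_trunc_dyadic F FU Foo t t01.
  move=> /cvgrPdist_lt /(_ _ (divr_gt0 e0 M1)); apply: filterS => j.
  rewrite ltr_pdivlMr // => tj; have /andP[t0 t1] := t01.
  have /andP[i1 i2] := @truncn_itv R (t * (2 ^ j)%:R) (mulr_ge0 t0 (ltW (N0 j))).
  rewrite /X; set s := _ / _ in tj *.
  have s01 : 0 <= s <= 1.
    rewrite /s ler_pdivrMr // (le_trans i1) ?ler_pM2r // andbT.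
    by rewrite divr_ge0 // ltW.
  apply: le_lt_trans (gL _ _ t01 s01) _; apply: le_lt_trans tj.
  by rewrite ler_wpM2l // lerDl.
apply: (eps_path_C1 _ _ _ _ _ h (w \o clamp01)) => //.
- by move=> t t01; rewrite hg // gg'.
- move=> t /=; apply: le_trans (wu _ (clamp01_itv t)) _.
  by have := ler_wpM2r u0 ke; lra.
Qed.

End Averaging.

End LocalGeometry.

(** * Uniform prox-regularity and the theorem *)

Lemma prox_regular_uniform (R : realType) (n : nat) (C : set 'rV[R]_n) (xb : 'rV[R]_n) :
  C xb -> prox_regular C xb -> exists r k : R, [/\ 0 < r, 0 < k, closed (C `&` ecball xb r) &
    forall x y v, (C `&` ecball xb r) x -> (C `&` ecball xb r) y -> reg_normal_cone C x v ->
      dotp v (y - x) <= k * enorm v * enorm (y - x) ^+ 2].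
Proof.
move=> Cxb [[r0 r00 clr0] prox].
have reg_normal x v : C x -> reg_normal_cone C x v -> normal_cone C x v.
  by move=> Cx xv; exists (fun=> x), (fun=> v); split=> //; exact: cvg_cst.
have /prox [e [rho [e0 rho0 H]]] : normal_cone C xb 0.
  apply: reg_normal => // e e0; exists 1 => // x _ _.
  by rewrite dotpC dotp0r mulr_ge0 ?enorm_ge0 // ltW.
(* Half of [e] puts the closed ball inside the open one; rescaling [v] to length [e / 2] costs the
   factor [2 |v| / e]. *)
exists (Num.min r0 (e / 2)), (2 * rho / e); split.
- by rewrite lt_min r00 divr_gt0.
- by rewrite divr_gt0 // mulr_gt0.
- rewrite (_ : C `&` _ = (C `&` ecball xb r0) `&` ecball xb (Num.min r0 (e / 2))).
    by apply: closedI => //; exact: closed_ecball.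
  apply/seteqP; split=> z /=; rewrite /ecball /= le_min; last by move=> [[? ?] ?].
  by move=> [Cz /andP[zr ze]]; split=> //; rewrite zr ze.
- have small z : ecball xb (Num.min r0 (e / 2)) z -> eball xb e z.
    by rewrite /ecball /eball /= le_min => /andP[_ ze]; lra.
  move=> x y v [Cx /small xe] [Cy /small ye] vN.
  have [v0|vn] := eqVneq (enorm v) 0.
    by rewrite v0 (enorm_eq0 _ v0) dotpC dotp0r mulr0 mul0r.
  have vp : 0 < enorm v by rewrite lt_neqAle eq_sym vn enorm_ge0.
  have c0 : 0 < e / (2 * enorm v) by rewrite divr_gt0 // mulr_gt0.
  have := H x y ((e / (2 * enorm v)) *: v) (conj Cx xe) (conj Cy ye); rewrite dotpZl.
  move=> Hv; have {Hv} : e / (2 * enorm v) * dotp v (y - x) <= rho * enorm (y - x) ^+ 2.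
    apply: Hv; split.
      apply: reg_normal => // e' e'0.
      have [d d0 dP] := vN (e' / (e / (2 * enorm v))) (divr_gt0 e'0 c0).
      exists d => // z Cz zd; rewrite dotpZl mulrC -ler_pdivlMr // mulrAC.
      exact: dP.
    rewrite /eball /= subr0 enormZ ger0_norm ?ltW //.
    have -> : e / (2 * enorm v) * enorm v = e / 2 by field.
    by lra.
  rewrite mulrC -ler_pdivlMr // => /le_trans; apply.
  by rewrite le_eqVlt; apply/orP; left; apply/eqP; field; rewrite gt_eqF.
Qed.

Theorem theorem3p19 (R : realType) (n : nat) (C : set 'rV[R]_n) (xb : 'rV[R]_n) :
  C xb -> prox_regular C xb ->
  smoothly_approx_convex C xb /\
  (forall e : R, 0 < e -> exists2 d : R, 0 < d &
     forall (x x' : 'rV[R]_n) (g : R -> 'rV[R]_n),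
       (C `&` eball xb d) x -> (C `&` eball xb d) x' ->
       averaging_map C x x' g -> eps_path C x x' e g).
Proof.
move=> Cxb /(prox_regular_uniform _ _ _ _ Cxb) [r [k [r0 k0 Kcl Kprox]]].
(* As [|y - x| < 2 d], the last condition gives [9 (32 k) |y - x| <= e], which also covers the
   smaller factor [8 k] of the smooth path. *)
have radius e : 0 < e -> exists d, [/\ 0 < d, 32 * d <= r, 32 * k * d <= 1 &
    18 * (32 * k) * d <= e].
  move=> e0; exists (Num.min (r / 32) (Num.min (32 * k)^-1 (e / (18 * (32 * k))))).
  set d := Num.min _ _.
  have /and3P[d1 d2 d3] : [&& d <= r / 32, d <= (32 * k)^-1 & d <= e / (18 * (32 * k))].
    by rewrite -!le_min.
  split.
  - by rewrite !lt_min !divr_gt0 ?invr_gt0 ?mulr_gt0.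
  - by move: d1; rewrite ler_pdivlMr // mulrC.
  - by move: d2; rewrite -[leRHS]mul1r ler_pdivlMr ?mulr_gt0 // mulrC.
  - by move: d3; rewrite ler_pdivlMr ?mulr_gt0 // mulrC.
have dist d x y : eball xb d x -> eball xb d y -> enorm (y - x) < 2 * d.
  rewrite /eball /= => xd yd.
  by have := enorm_sub_trans xb y x; rewrite (enormB xb x); lra.
split=> e e0; have [d [d0 d_r d_k d_e]] := radius e e0.
  exists (eball xb d); first exact: nbhs_eball.
  move=> x y [Cx xd] [Cy yd]; have u2d := dist _ _ _ xd yd.
  have u0 := enorm_ge0 (y - x); have xd' : enorm (x - xb) < d by [].
  have near_r : enorm (x - xb) + 4 * enorm (y - x) < r by lra.
  have ku : k * enorm (y - x) <= k * (2 * d) by rewrite ler_pM2l // ltW.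
  have kd := mulr_gt0 k0 d0.
  have small_u : 4 * k * enorm (y - x) <= 1 by lra.
  have [h [w [[hC h0 h1] hw wc wu _]]] :=
    smooth_path C xb r k k0 Kcl Kprox x y Cx Cy near_r small_u.
  exists h; apply: (eps_path_C1 _ _ _ _ _ h w) => // t.
  apply: le_trans (wu t) _.
  have k8 : 8 * k * enorm (y - x) <= e by lra.
  by have := ler_wpM2r u0 k8; lra.
exists d => // x y g [Cx xd] [Cy yd] gavg; have u2d := dist _ _ _ xd yd.
apply: (averaging_eps_path C xb r k k0 Kcl Kprox d x y g) => //.
apply: le_trans d_e.
have : k * enorm (y - x) <= k * (2 * d) by rewrite ler_pM2l // ltW.
by lra.
Qed.
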